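(* The adaptivity gap of correlated stochastic orienteering is $O(\log\log B)$: there is an absolute constant $C$ such that for every instance of correlated stochastic orienteering with budget $B\ge 4$, there is a non-adaptive policy whose expected reward is at least $\mathsf{Opt}/(C\log\log B)$, where $\mathsf{Opt}$ is the maximum expected reward of an adaptive policy.
   Context: Correlated stochastic orienteering: the input is a metric $(V,d)$ with $|V|=n$, symmetric nonnegative integer distances (travel times) satisfying the triangle inequality, a root $\rho\in V$, and an integer budget $B$. Each vertex $v$ holds a job whose size $S_v\in\{0,1,\dots,B\}$ and reward are random and possibly correlated: for each $s\in\{0,\dots,B\}$, with probability $\pi_v(s)=\Pr[S_v=s]$ the job has size $s$ and reward $r_v(s)\ge 0$. The distributions are independent across vertices. A policy starts at $\rho$, travels to vertices and runs jobs non-preemptively, learning a job's size (and reward) only upon completion; a job's reward is collected iff the total elapsed time (distance travelled plus sizes of all jobs processed so far, including this one) is at most $B$. An adaptive policy is a decision tree choosing the next vertex based on observed outcomes; a non-adaptive policy is a fixed path from $\rho$ (possibly chosen at random independently of the outcomes) whose jobs are processed in order until the budget is exhausted. *)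

(* Defs.v *)
From mathcomp Require Import all_boot all_order all_algebra.
From mathcomp Require Import all_classical all_reals all_analysis.

Set Implicit Arguments.
Unset Strict Implicit.
Unset Printing Implicit Defensive.

Import Order.TTheory GRing.Theory Num.Theory.
Local Open Scope classical_set_scope.
Local Open Scope ring_scope.

(* Distinct vertices may be at distance 0 (co-located jobs). *)
Record instance (R : realType) (V : finType) (B : nat) := Instance {
  dist : V -> V -> nat;
  root : V;
  prob : V -> 'I_B.+1 -> R;
  reward : V -> 'I_B.+1 -> R;
  dist_self : forall u, dist u u = 0%N;
  dist_sym : forall u v, dist u v = dist v u;
  dist_triangle : forall u v w, (dist u w <= dist u v + dist v w)%N;
  prob_ge0 : forall v s, 0 <= prob v s;
  prob_sum1 : forall v, \sum_s prob v s = 1;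
  reward_ge0 : forall v s, 0 <= reward v s }.

(* An outcome fixes the size of every job; sizes of distinct jobs are
   independent, so outcomes carry the product probability. *)
Definition outcome (V : finType) (B : nat) := {ffun V -> 'I_B.+1}.

Definition outcome_prob (R : realType) (V : finType) (B : nat)
    (I : instance R V B) (w : outcome V B) : R :=
  \prod_v prob I v (w v).

Definition expect (R : realType) (V : finType) (B : nat)
    (I : instance R V B) (X : outcome V B -> R) : R :=
  \sum_w outcome_prob I w * X w.

(* Reward collected from location u at elapsed time t when the jobs of p are
   visited and run in order; once the elapsed time exceeds B it stays above B,
   so continuing along p is the same as stopping. *)
Fixpoint collected (R : realType) (V : finType) (B : nat)
    (I : instance R V B) (w : outcome V B) (u : V) (t : nat) (p : seq V) : R :=
  if p is v :: p' then
    let t' := (t + dist I u v + w v)%N in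
    (if (t' <= B)%N then reward I v (w v) else 0) + collected I w v t' p'
  else 0.

Definition path_value (R : realType) (V : finType) (B : nat)
    (I : instance R V B) (p : seq V) : R :=
  expect I (fun w => collected I w (root I) 0 p).

(* Adaptive policies: the subtree entered after a job depends on its observed
   size, which also determines the observed reward. *)
Inductive decision_tree (V : Type) (B : nat) :=
| Stop
| Visit (v : V) (next : 'I_B.+1 -> decision_tree V B).

Fixpoint executed (V : finType) (B : nat) (T : decision_tree V B)
    (w : outcome V B) : seq V :=
  if T is Visit v next then v :: executed (next (w v)) w else [::].

(* Each job is run at most once. *)
Definition adaptive_policy (V : finType) (B : nat) (T : decision_tree V B) :=
  forall w, uniq (executed T w).

Definition adaptive_value (R : realType) (V : finType) (B : nat)
    (I : instance R V B) (T : decision_tree V B) : R :=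
  expect I (fun w => collected I w (root I) 0 (executed T w)).

(* The supremum is attained, see [Opt_attained]. *)
Definition Opt (R : realType) (V : finType) (B : nat) (I : instance R V B) : R :=
  sup [set adaptive_value I T | T in @adaptive_policy V B].

(* A distribution on the paths that run each job at most once; such paths have
   at most #|V| vertices. *)
Record nonadaptive_policy (R : realType) (V : finType) := NonadaptivePolicy {
  path_prob : #|V|.-bseq V -> R;
  path_prob_ge0 : forall p, 0 <= path_prob p;
  path_prob_sum1 : \sum_p path_prob p = 1;
  path_prob_uniq : forall p, path_prob p != 0 -> uniq p }.

Definition nonadaptive_value (R : realType) (V : finType) (B : nat)
    (I : instance R V B) (N : nonadaptive_policy R V) : R :=
  \sum_p path_prob N p * path_value I p.

Definition log2 (R : realType) (x : R) : R := ln x / ln 2.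

Lemma Opt_max_exists (R : realType) (V : finType) (B : nat)
    (I : instance R V B) :
  exists2 T, adaptive_policy T &
    forall T', adaptive_policy T' -> adaptive_value I T' <= adaptive_value I T.
Proof.
pose F := {ffun outcome V B -> #|V|.-bseq V}.
pose real (f : F) (T : decision_tree V B) :=
  adaptive_policy T /\ forall w, f w = executed T w :> seq V.
pose val (f : F) : R := expect I (fun w => collected I w (root I) 0 (f w)).
have valE f T : real f T -> val f = adaptive_value I T.
  by case=> _ fT; apply: eq_bigr => w _; rewrite fT.
have ex T : adaptive_policy T -> exists f, real f T.
  move=> uT.
  have sz w : (size (executed T w) <= #|V|)%N.
    by rewrite -(card_uniqP (uT w)) max_card.
  by exists [ffun w => Bseq (sz w)]; split => // w; rewrite ffunE.
pose P f := `[< exists T, real f T >].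
have [f0 f0P] : exists f, P f.
  have [|f rf] := ex (@Stop V B); first by move=> w.
  by exists f; apply/asboolP; exists (@Stop V B).
case: (Order.TotalTheory.arg_maxP val f0P) => f /asboolP[T rT] fmax.
exists T; first by case: rT.
move=> T' uT'; have [f' rf'] := ex T' uT'.
rewrite -(valE _ _ rT) -(valE _ _ rf'); apply: fmax.
by apply/asboolP; exists T'.
Qed.

Lemma adaptive_value_le_Opt (R : realType) (V : finType) (B : nat)
    (I : instance R V B) (T : decision_tree V B) :
  adaptive_policy T -> adaptive_value I T <= Opt I.
Proof.
move=> uT; have [T0 uT0 T0max] := Opt_max_exists I.
apply: ub_le_sup; last by exists T.
by exists (adaptive_value I T0) => _ [T' uT' <-]; apply: T0max.
Qed.

Lemma Opt_attained (R : realType) (V : finType) (B : nat)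
    (I : instance R V B) :
  exists2 T, adaptive_policy T & adaptive_value I T = Opt I.
Proof.
have [T uT Tmax] := Opt_max_exists I; exists T => //.
apply/le_anti; rewrite adaptive_value_le_Opt //=.
apply: ge_sup; first by exists (adaptive_value I T), T.
by move=> _ [T' uT' <-]; apply: Tmax.
Qed.

(* Main.v *)
Require Import Defs.
From mathcomp Require Import all_boot all_order all_algebra.
From mathcomp Require Import all_classical all_reals all_analysis.
From mathcomp Require Import zify ring lra.

(** Put the job sizes seen so far at scale [j] as their sizes capped at [2^j],
    in units of [2^j]; only [O(log B)] scales matter.  Along an optimal tree,
    [P j], the product of the factors [1 - capped j s / 4] of the observed
    sizes [s], stays at least [1/2] as long as their total is at most
    [2^(j+1)], while [c j] accumulates [q] times the expected capped sizes.  As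
    [exp (K/2 (c j - 1/2)) P j] is a supermartingale when [2 q K = 1], the
    optimal tree rarely reaches a node whose total size [W] has scale [j] and
    where [c j > 1/2]: with [K] of order [log log B] this costs at most half of
    [Opt].  At all other nodes, a path that keeps each job with probability [q]
    independently has total size at most [W] with probability at least
    [1 - c j >= 1/2] by Markov's inequality, so it collects at least as much
    from the next job.  Hence some root-to-leaf path of the tree, thinned at
    rate [q] of order [1 / log log B], is good enough. *)

Set Implicit Arguments.
Unset Strict Implicit.
Unset Printing Implicit Defensive.

Import Order.TTheory GRing.Theory Num.Theory.
Local Open Scope ring_scope.

(** * Product expectation and resampling of one coordinate *)

Section Policies.
Context {R : realType} {V : finType} {B : nat}.
Variable I : instance R V B.
Implicit Types (w : outcome V B) (T : decision_tree V B) (S : seq V).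

Definition update w v s : outcome V B := [ffun x => if x == v then s else w x].

Lemma outcome_probD1 w v :
  outcome_prob I w = prob I v (w v) * \prod_(x | x != v) prob I x (w x).
Proof. by rewrite /outcome_prob (bigD1 v). Qed.

(** Exchanging the size of [v] with an independent fresh sample is an involution that preserves the
    product weight. *)
Lemma expect_resample v (X : outcome V B -> R) :
  expect I X = \sum_s prob I v s * expect I (fun w => X (update w v s)).
Proof.
pose swap (a : outcome V B * 'I_B.+1) := (update a.1 v a.2, a.1 v).
have swapK : involutive swap.
  case=> w s; rewrite /swap /= ffunE eqxx; congr pair.
  by apply/ffunP => x; rewrite !ffunE; case: eqP => // ->.
transitivity (\sum_(a : outcome V B * 'I_B.+1)
    prob I v a.2 * (outcome_prob I a.1 * X a.1)).
  rewrite -(pair_bigA _ (fun w s => prob I v s * (outcome_prob I w * X w))) /=.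
  by apply: eq_bigr => w _; rewrite -mulr_suml prob_sum1 mul1r.
rewrite (reindex_inj (inv_inj swapK)) /=.
rewrite -(pair_bigA _ (fun w s => prob I v (w v) *
  (outcome_prob I (update w v s) * X (update w v s)))) /= exchange_big /=.
apply: eq_bigr => s _; rewrite /expect mulr_sumr; apply: eq_bigr => w _.
rewrite !(outcome_probD1 _ v) ffunE eqxx.
rewrite (eq_bigr (fun x => prob I x (w x))); first by ring.
by move=> x /negPf xv; rewrite ffunE xv.
Qed.

Lemma expect_cst (a : R) : expect I (fun=> a) = a.
Proof.
rewrite /expect -mulr_suml /outcome_prob.
rewrite -(bigA_distr_bigA (fun v s => prob I v s)) big1 ?mul1r // => v _.
exact: prob_sum1.
Qed.

Lemma expectD (X Y : outcome V B -> R) :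
  expect I (fun w => X w + Y w) = expect I X + expect I Y.
Proof. by rewrite /expect -big_split; apply: eq_bigr => w _; rewrite mulrDr. Qed.

(** * Structural form of never repeating a job *)

Fixpoint avoids S T : Prop :=
  if T is Visit v next then v \notin S /\ forall s, avoids (v :: S) (next s)
  else True.

(** Induction on the tree, where [S] holds the jobs already run and [w0] the sizes observed on them:
    the outcomes agreeing with [w0] on [S] are those that lead to the current subtree. *)
Lemma adaptive_policy_avoids T : adaptive_policy T -> avoids [::] T.
Proof.
move=> uT.
suff gen S (w0 : outcome V B) :
    (forall w, {in S, w =1 w0} ->
      uniq (executed T w) /\ {in executed T w, forall x, x \notin S}) ->
    avoids S T.
  by apply: (gen [::] [ffun=> ord0]) => w _; split => // x.
elim: T S w0 {uT} => [//|v next IH] S w0 H /=.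
have vS : v \notin S by have [//|_ ] := H w0; apply; rewrite /= mem_head.
split=> // s; apply: (IH s _ (update w0 v s)) => w ww.
have wv : w v = s by rewrite ww ?mem_head // ffunE eqxx.
have [x xS|] := H w.
  rewrite ww ?inE ?xS ?orbT // ffunE; case: eqP => // xv.
  by rewrite -xv xS in vS.
rewrite /= wv => /andP[vn un] nS; split => // x xn.
rewrite inE negb_or nS ?inE ?xn ?orbT // andbT.
by apply: contraNneq vn => <-.
Qed.

Lemma avoids_adaptive_policy S T : avoids S T -> adaptive_policy T.
Proof.
move=> aT w.
suff [] : uniq (executed T w) /\ {in executed T w, forall x, x \notin S} by [].
elim: T S aT => [//|v next IH] S /= [vS /(_ (w v))/IH [un nS]]; split.
  rewrite un andbT; apply/negP => /nS; by rewrite mem_head.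
move=> x; rewrite inE => /predU1P[-> //|/nS].
by rewrite inE negb_or => /andP[].
Qed.

Lemma collected_executed_off S T w w' u t : avoids S T ->
  (forall x, x \notin S -> w x = w' x) ->
  collected I w u t (executed T w) = collected I w' u t (executed T w').
Proof.
move=> + ww; elim: T S u t ww => [//|v next IH] S u t ww /= [vS aT].
rewrite -(ww _ vS); congr (_ + _); apply: IH (aT _) => x.
by rewrite inE negb_or => /andP[_ /ww].
Qed.

(** * Recursive value of a tree and its monotonicity in time *)

Definition gain v t : R :=
  \sum_(s < B.+1) prob I v s * (if (t + s <= B)%N then reward I v s else 0).

Fixpoint value T u t : R :=
  if T is Visit v next then
    gain v (t + dist I u v) +
    \sum_(s < B.+1) prob I v s * value (next s) v (t + dist I u v + s)%N
  else 0.

Lemma expect_collected S T u t : avoids S T ->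
  expect I (fun w => collected I w u t (executed T w)) = value T u t.
Proof.
elim: T S u t => [|v next IH] S u t /=; first by rewrite expect_cst.
case=> vS aT; rewrite (expect_resample v) /gain -big_split /=.
apply: eq_bigr => s _; rewrite -mulrDr -(IH s _ _ _ (aT s)); congr (_ * _).
rewrite -[X in X + _]expect_cst -expectD; apply: eq_bigr => w _.
congr (_ * _); rewrite ffunE eqxx; congr (_ + _).
apply: collected_executed_off (aT s) _ => x.
by rewrite inE negb_or ffunE => /andP[/negPf ->].
Qed.

Lemma adaptive_valueE T :
  adaptive_policy T -> adaptive_value I T = value T (Defs.root I) 0.
Proof. by move=> /adaptive_policy_avoids; apply: expect_collected. Qed.

Lemma gain_ge0 v t : 0 <= gain v t.
Proof.
apply: sumr_ge0 => s _; rewrite mulr_ge0 ?prob_ge0 //.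
by case: ifP => _ //; apply: reward_ge0.
Qed.

Lemma gain_le v t t' : (t <= t')%N -> gain v t' <= gain v t.
Proof.
move=> tt'; apply: ler_sum => s _; apply: ler_wpM2l; first exact: prob_ge0.
case: ifP => h; first by rewrite ifT //; lia.
by case: ifP => _ //; apply: reward_ge0.
Qed.

Lemma gain_late v t : (B < t)%N -> gain v t = 0.
Proof.
by move=> Bt; rewrite /gain big1 // => s _; rewrite ifF ?mulr0 //; lia.
Qed.

Lemma value_late T u t : (B < t)%N -> value T u t = 0.
Proof.
elim: T u t => [//|v next IH] u t Bt /=.
rewrite gain_late ?big1 ?addr0 //; last by lia.
by move=> s _; rewrite IH ?mulr0 //; lia.
Qed.

(** By the triangle inequality, an earlier start at [u] reaches every later vertex no later than a
    detour through [u']. *)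
Lemma value_le T u t u' t' : (t + dist I u u' <= t')%N ->
  value T u' t' <= value T u t.
Proof.
elim: T u t u' t' => [//|v next IH] u t u' t' h /=.
have := dist_triangle I u u' v.
move=> tr; apply: lerD; first by apply: gain_le; lia.
apply: ler_sum => s _; apply: ler_wpM2l; first exact: prob_ge0.
by apply: IH; rewrite dist_self; lia.
Qed.

Lemma value_le_Opt S T u t : avoids S T -> (dist I (Defs.root I) u <= t)%N ->
  value T u t <= Opt I.
Proof.
move=> /avoids_adaptive_policy aT h.
apply: le_trans (adaptive_value_le_Opt I aT); rewrite adaptive_valueE //.
exact: value_le.
Qed.

Lemma Opt_ge0 : 0 <= Opt I.
Proof.
have := @value_le_Opt [::] (Stop V B) (Defs.root I) 0 Logic.I.
by rewrite dist_self; apply.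
Qed.

(** A fixed path is a tree that ignores the observed sizes, so [value] serves both kinds of
    policy. *)
Fixpoint path_tree (p : seq V) : decision_tree V B :=
  if p is v :: p' then Visit v (fun=> path_tree p') else Stop V B.

Lemma executed_path_tree p w : executed (path_tree p) w = p.
Proof. by elim: p => //= v p ->. Qed.

Lemma path_valueE p : uniq p -> path_value I p = value (path_tree p) (Defs.root I) 0.
Proof.
move=> up; rewrite -adaptive_valueE; last by move=> w; rewrite executed_path_tree.
by apply: eq_bigr => w _; rewrite executed_path_tree.
Qed.

Lemma average_le_some (v : V) (F : 'I_B.+1 -> R) :
  exists s, \sum_s prob I v s * F s <= F s.
Proof.
have [s _ Fmax] := Order.TotalTheory.arg_maxP (P := predT) F (i0 := ord0) isT.
exists s; rewrite -[leRHS]mul1r -(prob_sum1 I v) mulr_suml.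
by apply: ler_sum => x _; apply: ler_wpM2l; [exact: prob_ge0|exact: Fmax].
Qed.

(** * Capped sizes and scales *)

Definition capped (j s : nat) : R := (minn s (2 ^ j))%:R / (2 ^ j)%:R.

Definition mean_capped v j : R := \sum_(s < B.+1) prob I v s * capped j s.

Lemma pow2_gt0 j : 0 < (2 ^ j)%:R :> R.
Proof. by rewrite ltr0n expn_gt0. Qed.

Lemma capped_ge0 j s : 0 <= capped j s.
Proof. by rewrite divr_ge0 // ler0n. Qed.

Lemma capped_le1 j s : capped j s <= 1.
Proof. by rewrite ler_pdivrMr ?pow2_gt0 // mul1r ler_nat geq_minr. Qed.

Lemma capped_le j s : capped j s <= s%:R / (2 ^ j)%:R.
Proof. by rewrite ler_pM2r ?invr_gt0 ?pow2_gt0 // ler_nat geq_minl. Qed.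

Lemma capped_full j s : (2 ^ j <= s)%N -> capped j s = 1.
Proof. by move=> h; rewrite /capped (minn_idPr h) divff // gt_eqF ?pow2_gt0. Qed.

Lemma cappedD j s s' : capped j (s + s') <= capped j s + capped j s'.
Proof.
rewrite -mulrDl -natrD ler_pM2r ?invr_gt0 ?pow2_gt0 // ler_nat; lia.
Qed.

(* The shift by one makes the scale of [0] meaningful: [2 ^ scale W <= W + 1]. *)
Definition scale W := trunc_log 2 W.+1.

(** * Random thinning of a branch *)

Section Thinning.
Variable q : R.
Hypotheses (q_gt0 : 0 < q) (q_le1 : q <= 1).

(* The mean of [F] over the random subsequence keeping each vertex with
   probability [q] independently. *)
Fixpoint thin (p : seq V) (F : seq V -> R) : R :=
  if p is v :: p' then
    (1 - q) * thin p' F + q * thin p' (fun r => F (v :: r))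
  else F [::].

Lemma thin_le_some p F : exists2 r, subseq r p & thin p F <= F r.
Proof.
elim: p F => [|v p IH] F /=; first by exists [::].
have [r1 s1 h1] := IH F; have [r2 s2 h2] := IH (fun r => F (v :: r)).
have q1 : 0 <= 1 - q by rewrite subr_ge0.
have h : (1 - q) * thin p F + q * thin p (fun r => F (v :: r)) <=
    (1 - q) * F r1 + q * F (v :: r2).
  by apply: lerD; apply: ler_wpM2l => //; apply: ltW.
have [h'|h'] := leP (F r1) (F (v :: r2)).
  exists (v :: r2); first by rewrite /= eqxx.
  by have := ler_wpM2l q1 h'; lra.
exists r1; last by have := ler_wpM2l (ltW q_gt0) (ltW h'); lra.
exact: subseq_trans s1 (subseq_cons _ _).
Qed.

Lemma thin_affine p a (b : 'I_B.+1 -> R) (F : 'I_B.+1 -> seq V -> R) :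
  thin p (fun r => a + \sum_s b s * F s r) = a + \sum_s b s * thin p (F s).
Proof.
elim: p F => [//|v p IH] F /=; rewrite IH (IH (fun s r => F s (v :: r))).
rewrite [X in _ = _ + X](eq_bigr (fun s => (1 - q) * (b s * thin p (F s)) +
  q * (b s * thin p (fun r => F s (v :: r))))); last by move=> s _; ring.
by rewrite big_split /= -!mulr_sumr; ring.
Qed.

(* [l] is a branch of the tree with its observed sizes, [D] the distance
   travelled and [W] the total size along it; [1 - c (scale W)] is the Markov
   bound for the thinned path to have total size at most [W]. *)
Fixpoint discounted (l : seq (V * 'I_B.+1)) u D W (c : nat -> R) : R :=
  if l is (v, s) :: l' then
    gain v (D + dist I u v + W) * (1 - c (scale W)) +
    discounted l' v (D + dist I u v)%N (W + s)%N (fun j => c j + q * mean_capped v j)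
  else 0.

Lemma discounted_le l u D W c c' : (forall j, c j <= c' j) ->
  discounted l u D W c' <= discounted l u D W c.
Proof.
elim: l u D W c c' => [//|[v s] l IH] u D W c c' cc' /=; apply: lerD.
  by apply: ler_wpM2l; rewrite ?gain_ge0 // lerB.
by apply: IH => j; rewrite lerD2r.
Qed.

(** Each discount is affine in [c], so averages over the coin and over a fresh size can be moved
    into [c]. *)
Lemma discounted_affine (J : finType) (a : J -> R) (C : J -> nat -> R) l u D W :
  \sum_i a i = 1 ->
  \sum_i a i * discounted l u D W (C i) =
  discounted l u D W (fun j => \sum_i a i * C i j).
Proof.
move=> a1; elim: l u D W C => [|[v s] l IH] u D W C /=.
  by rewrite big1 // => i _; rewrite mulr0.
under eq_bigr do rewrite mulrDr.
rewrite big_split /= IH; congr (_ + _).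
  transitivity (\sum_i (gain v (D + dist I u v + W) * a i -
      gain v (D + dist I u v + W) * (a i * C i (scale W)))).
    by apply: eq_bigr => i _; ring.
  by rewrite sumrB -!mulr_sumr a1; ring.
congr discounted; apply/funext => j /=.
under eq_bigr do rewrite mulrDr.
by rewrite big_split /= -[in RHS](mul1r (q * _)) -a1 mulr_suml.
Qed.

(* [W'] is the total size actually consumed by the thinned path so far. *)
Lemma discounted_le_thin l u0 D0 u D W W' : (D + dist I u u0 <= D0)%N ->
  q * discounted l u0 D0 W (fun j => capped j W') <=
  thin (map fst l) (fun p => value (path_tree p) u (D + W')).
Proof.
elim: l u0 D0 u D W W' => [|[v s] l IH] u0 D0 u D W W' h /=; first by rewrite mulr0.
have tr := dist_triangle I u u0 v.
set D0' := (D0 + dist I u0 v)%N; pose D' := (D + dist I u v)%N.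
rewrite thin_affine.
have skip : q * discounted l v D0' (W + s) (fun j => capped j W') <=
    thin (map fst l) (fun p => value (path_tree p) u (D + W')).
  by apply: IH; rewrite /D0'; lia.
(* The size [s'] met by the thinned path is unrelated to the size [s] recorded on the branch: [s]
   enters only [W], and [s'] only [W']. *)
have take (s' : 'I_B.+1) :
    q * discounted l v D0' (W + s) (fun j => capped j W' + capped j s') <=
    thin (map fst l) (fun p => value (path_tree p) v (D + W' + dist I u v + s')).
  apply: (@le_trans _ _
    (q * discounted l v D0' (W + s) (fun j => capped j (W' + s')))).
    by rewrite ler_pM2l //; apply: discounted_le => j; apply: cappedD.
  have -> : (D + W' + dist I u v + s' = D' + (W' + s'))%N by rewrite /D'; lia.
  by apply: IH; rewrite dist_self /D' /D0'; lia.
(* This is Markov's inequality pointwise: if [W' <= W] the thinned path arrives no later; otherwise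
   [2 ^ scale W <= W + 1 <= W'], and the discount factor vanishes. *)
have now : gain v (D0' + W) * (1 - capped (scale W) W') <=
    gain v (D + W' + dist I u v).
  have [WW|WW] := leqP W' W.
    apply: (@le_trans _ _ (gain v (D0' + W))).
      by rewrite ler_piMr ?gain_ge0 // gerBl capped_ge0.
    by apply: gain_le; rewrite /D0'; lia.
  rewrite capped_full ?subrr ?mulr0 ?gain_ge0 //.
  by apply: leq_trans WW; apply: trunc_logP.
have aff : discounted l v D0' (W + s) (fun j => capped j W' + q * mean_capped v j) =
    (1 - q) * discounted l v D0' (W + s) (fun j => capped j W') +
    q * \sum_s' prob I v s' *
      discounted l v D0' (W + s) (fun j => capped j W' + capped j s').
  rewrite (discounted_affine (fun s' j => capped j W' + capped j (nat_of_ord s'))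
    l v D0' (W + s)%N (prob_sum1 I v)).
  (* The coin deciding whether [v] is kept is a second average, indexed by [bool], with [true] for
     skipping. *)
  have := @discounted_affine bool (fun b => if b then 1 - q else q)
    (fun b j => if b then capped j W' else
      \sum_s' prob I v s' * (capped j W' + capped j s')) l v D0' (W + s)%N.
  rewrite !big_bool /= => ->; last by rewrite subrK.
  congr discounted; apply/funext => j; rewrite big_bool /=.
  rewrite (eq_bigr (fun s' => prob I v s' * capped j W' + prob I v s' * capped j s'))
    => [|i _]; last by rewrite mulrDr.
  by rewrite big_split /= -mulr_suml prob_sum1 /mean_capped; ring.
have takes : q * \sum_s' prob I v s' *
      discounted l v D0' (W + s) (fun j => capped j W' + capped j (nat_of_ord s')) <=
    \sum_(s' < B.+1) prob I v s' *
      thin (map fst l) (fun p => value (path_tree p) v (D + W' + dist I u v + s')).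
  rewrite mulr_sumr; apply: ler_sum => s' _; rewrite mulrCA.
  by apply: ler_wpM2l; [exact: prob_ge0|exact: take].
have q1 : 0 <= 1 - q by rewrite subr_ge0.
have := lerD (ler_wpM2l q1 skip) (ler_wpM2l (ltW q_gt0) (lerD now takes)).
by rewrite aff; apply: le_trans; rewrite le_eqVlt; apply/orP; left; apply/eqP; ring.
Qed.

(** * The exponential potential and the choice of a branch *)

Variable K : R.
Hypothesis qK : 2 * q * K = 1.

(** A union bound over the scales; the factor 2 offsets [P j], which may have dropped to [1/2] at a
    cut. *)
Definition overrun_bound n (c P : nat -> R) : R :=
  \sum_(j < n) 2 * expR (K / 2 * (c j - 1 / 2)) * P j.

Lemma K_gt0 : 0 < K.
Proof. by rewrite -(pmulr_rgt0 _ (x := 2 * q)) ?qK // mulr_gt0. Qed.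

Lemma overrun_bound_ge0 n c P : (forall j, 0 <= P j) -> 0 <= overrun_bound n c P.
Proof.
by move=> P0; apply: sumr_ge0 => j _; rewrite mulr_ge0 // mulr_ge0 // expR_ge0.
Qed.

Lemma overrun_bound_ge1 n c P W : (forall j, 0 <= P j) ->
  (scale W < n)%N -> 1 / 2 < c (scale W) ->
  1 - W%:R / (4 * (2 ^ scale W)%:R) <= P (scale W) ->
  1 <= overrun_bound n c P.
Proof.
move=> P0 jn cW PW; rewrite /overrun_bound (bigD1 (Ordinal jn)) //=.
apply: (@le_trans _ _ (2 * expR (K / 2 * (c (scale W) - 1 / 2)) * P (scale W))).
  have W2 : W%:R / (4 * (2 ^ scale W)%:R) <= 1 / 2 :> R.
    rewrite ler_pdivrMr; last by rewrite mulr_gt0 ?pow2_gt0.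
    have : (W <= 2 * 2 ^ scale W)%N.
      by have := trunc_log_ltn W.+1 (isT : (1 < 2)%N); rewrite expnS /scale; lia.
    by rewrite -(ler_nat R) natrM; lra.
  have e1 : 1 <= expR (K / 2 * (c (scale W) - 1 / 2)).
    have k0 := K_gt0.
    have k2 : 0 <= K / 2 by rewrite divr_ge0 // ltW.
    by rewrite -[leLHS]expR0 ler_expR mulr_ge0 // subr_ge0 ltW.
  have P2 : 1 / 2 <= P (scale W) by lra.
  have h0 : 0 <= 1 / 2 :> R by lra.
  have := ler_pM ler01 h0 e1 P2; lra.
rewrite lerDl; apply: sumr_ge0 => j _.
by rewrite mulr_ge0 // mulr_ge0 // expR_ge0.
Qed.

(** Supermartingale property: as [2 q K = 1], one job multiplies the mean of each term by
    [exp (m/4) (1 - m/4) <= 1], where [m] is its mean capped size. *)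
Lemma overrun_bound_average n c P v : (forall j, 0 <= P j) ->
  \sum_s prob I v s * overrun_bound n (fun j => c j + q * mean_capped v j)
    (fun j => P j * (1 - capped j (nat_of_ord s) / 4)) <=
  overrun_bound n c P.
Proof.
move=> P0; rewrite /overrun_bound.
under eq_bigr do rewrite mulr_sumr.
rewrite exchange_big /=; apply: ler_sum => j _.
set m := mean_capped v j.
have -> : K / 2 * (c j + q * m - 1 / 2) = K / 2 * (c j - 1 / 2) + m / 4.
  by rewrite -[X in _ = _ + X]mul1r -[X in _ = _ + X * _]qK; field.
rewrite expRD.
set e := expR (K / 2 * _).
have -> : \sum_(s < B.+1) prob I v s *
    (2 * (e * expR (m / 4)) * (P j * (1 - capped j s / 4))) =
    2 * e * P j * (expR (m / 4) * (1 - m / 4)).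
  transitivity (\sum_(s < B.+1) (2 * (e * expR (m / 4)) * P j * prob I v s -
     2 * (e * expR (m / 4)) * P j / 4 * (prob I v s * capped j s))).
    by apply: eq_bigr => s _; field.
  by rewrite sumrB -!mulr_sumr prob_sum1 -/(mean_capped v j) -/m; field.
rewrite ler_piMr //; first by rewrite mulr_ge0 // mulr_ge0 // expR_ge0.
rewrite mulrC -ler_pdivlMr ?expR_gt0 // div1r -expRN.
exact: expR_ge1Dx.
Qed.

(* The branch is cut where [c (scale W) > 1/2]; the value lost there, at most
   [Opt], is paid by the potential [overrun_bound], which then exceeds [1]. *)
Lemma tree_to_path n T S u D W c P :
  (forall W', (W' <= B)%N -> (scale W' < n)%N) ->
  avoids S T -> (dist I (Defs.root I) u <= D)%N ->
  (forall j, [/\ 0 <= P j, P j <= 1 & 1 - W%:R / (4 * (2 ^ j)%:R) <= P j]) ->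
  exists l, [/\ uniq (map fst l), {in map fst l, forall x, x \notin S} &
    value T u (D + W) <= 2 * discounted l u D W c + Opt I * overrun_bound n c P].
Proof.
move=> scale_n; elim: T S u D W c P => [|v next IH] S u D W c P aT ruD PP.
  exists [::]; split => //=; rewrite mulr0 add0r mulr_ge0 ?Opt_ge0 //.
  by apply: overrun_bound_ge0 => j; case: (PP j).
have P0 j : 0 <= P j by case: (PP j).
have [cW|cW] := ltP (1 / 2) (c (scale W)).
  exists [::]; split => //; rewrite [discounted _ _ _ _ _]/= mulr0 add0r.
  have [WB|BW] := leqP W B; last first.
    rewrite value_late; last by lia.
    by rewrite mulr_ge0 ?Opt_ge0 ?overrun_bound_ge0.
  apply: (@le_trans _ _ (Opt I)); first by apply: value_le_Opt aT _; lia.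
  rewrite ler_peMr ?Opt_ge0 //; apply: (overrun_bound_ge1 P0 (scale_n _ WB) cW).
  by case: (PP (scale W)).
case: aT => vS aT; set D' := (D + dist I u v)%N.
pose c' j := c j + q * mean_capped v j.
pose P' (s : 'I_B.+1) j := P j * (1 - capped j s / 4).
have step (s : 'I_B.+1) : exists l, [/\ uniq (map fst l),
    {in map fst l, forall x, x \notin v :: S} &
    value (next s) v (D' + (W + s)) <=
    2 * discounted l v D' (W + s) c' + Opt I * overrun_bound n c' (P' s)].
  have ruD' : (dist I (Defs.root I) v <= D')%N.
    by rewrite /D'; have := dist_triangle I (Defs.root I) u v; lia.
  apply: (IH s (v :: S) v D' (W + s)%N c' (P' s) (aT s) ruD') => j.
  have [p0 p1 pW] := PP j.
  (* The lower bound on [P] survives because [P j <= 1] makes the factor [1 - capped j s / 4] cost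
     at most [s / (4 * 2^j)]. *)
  have := capped_ge0 j s; have := capped_le1 j s; have := capped_le j s.
  rewrite /P' natrD mulrDl => xs x1 x0.
  have -> : s%:R / (4 * (2 ^ j)%:R) = s%:R / (2 ^ j)%:R / 4 :> R.
    by field; rewrite gt_eqF ?pow2_gt0.
  have px : P j * (capped j s / 4) <= capped j s / 4 by rewrite ler_piMl // divr_ge0.
  have px0 : 0 <= P j * (capped j s / 4) by rewrite mulr_ge0 // divr_ge0.
  set y := capped j s in xs x1 x0 px px0 *; set z := s%:R / _ in xs *.
  have -> : P j * (1 - y / 4) = P j - P j * (y / 4) by ring.
  have pxP : P j * (y / 4) <= P j by rewrite ler_piMr //; lra.
  by split; lra.
have [L LP] := choice step.
(* The branch follows the size with the best discounted value, while the potential stays averaged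
   over all sizes. *)
have [s0 s0max] := average_le_some v (fun s => discounted (L s) v D' (W + s) c').
exists ((v, s0) :: L s0); have [Lu LS _] := LP s0; split=> /=.
- rewrite Lu andbT; apply/negP => /LS; by rewrite mem_head.
- move=> x; rewrite inE => /predU1P[-> //|/LS].
  by rewrite inE negb_or => /andP[].
have now : gain v (D' + W) <= 2 * (gain v (D' + W) * (1 - c (scale W))).
  have c2 : 1 / 2 <= 1 - c (scale W) by lra.
  by have := ler_wpM2l (gain_ge0 v (D' + W)) c2; lra.
have later : \sum_(s < B.+1) prob I v s * value (next s) v (D' + W + s) <=
    2 * discounted (L s0) v D' (W + s0) c' + Opt I * overrun_bound n c P.
  apply: (@le_trans _ _ (2 * (\sum_s prob I v s * discounted (L s) v D' (W + s) c') +
      Opt I * \sum_s prob I v s * overrun_bound n c' (P' s))).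
    rewrite !mulr_sumr -big_split /=; apply: ler_sum => s _.
    rewrite mulrCA [Opt I * _]mulrCA -mulrDr; apply: ler_wpM2l; first exact: prob_ge0.
    by rewrite -addnA; have [] := LP s.
  apply: lerD; first by rewrite ler_pM2l.
  by apply: ler_wpM2l; [exact: Opt_ge0|exact: overrun_bound_average].
have -> : (D + W + dist I u v = D' + W)%N by rewrite /D'; lia.
by apply: le_trans (lerD now later) _; rewrite addrA -mulrDr.
Qed.

End Thinning.

(** * Choice of parameters and the resulting path *)

Lemma path_ge_Opt n : (scale B < n)%N ->
  exists2 p, uniq p & Opt I / (32 * ln (4 * n%:R)) <= path_value I p.
Proof.
move=> Bn.
have n1 : 1 <= n%:R :> R by rewrite ler1n; lia.
set x : R := 4 * n%:R.
have x4 : 4 <= x by rewrite /x; lra.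
have x0 : 0 < x by lra.
have lnx : 3 / 4 <= ln x.
  have xV : x^-1 <= 1 / 4 by rewrite -div1r ler_pdivrMr //; lra.
  have := @le_ln1Dx R (x^-1 - 1).
  rewrite addrCA subrr addr0 lnV ?posrE // => h.
  have xV0 : 0 < x^-1 by rewrite invr_gt0.
  have : -1 < x^-1 - 1 by lra.
  by move=> /h; lra.
(* With [c = 0] and [P = 1] each of the [n] potential terms is then [2 exp (- ln x) = 2 / x], so
   they add up to [1/2]. *)
pose K := 4 * ln x; pose q := (2 * K)^-1.
have K1 : 1 <= K by rewrite /K; lra.
have q0 : 0 < q by rewrite invr_gt0; lra.
have q1 : q <= 1 by rewrite invf_le1; lra.
have qK : 2 * q * K = 1 by rewrite /q; field; rewrite gt_eqF //; lra.
have [T uT TO] := Opt_attained I.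
have sn W' : (W' <= B)%N -> (scale W' < n)%N.
  by move=> h; apply: leq_ltn_trans Bn; apply: leq_trunc_log; lia.
have c0 (j : nat) : capped j 0 = 0 by rewrite /capped min0n mul0r.
(* The initial [c], which is zero, is written [capped j 0] to match [discounted_le_thin] at
   [W' = 0]. *)
have [l [ul _ hl]] := @tree_to_path q q0 q1 K qK n T [::] (Defs.root I) 0 0
  (fun j => capped j 0) (fun=> 1) sn (adaptive_policy_avoids uT)
  ltac:(by rewrite dist_self) ltac:(by move=> j; rewrite mul0r subr0).
have [p sp hp] := thin_le_some q0 q1 (map fst l)
  (fun p => value (path_tree p) (Defs.root I) (0 + 0)).
have up := subseq_uniq sp ul.
exists p => //; rewrite path_valueE //.
have := @discounted_le_thin q q0 q1 l (Defs.root I) 0 (Defs.root I) 0 0 0.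
rewrite dist_self => /(_ isT) hd.
have bound : overrun_bound K n (fun j => capped j 0) (fun=> 1) = 1 / 2.
  rewrite /overrun_bound (eq_bigr (fun=> 2 / x)) => [|j _].
    rewrite sumr_const card_ord -mulr_natr /x; field.
    by rewrite gt_eqF //; lra.
  rewrite c0 mulr1; have -> : K / 2 * (0 - 1 / 2) = - ln x by rewrite /K; field.
  by rewrite expRN lnK // posrE.
move: hl; rewrite addn0 -(adaptive_valueE uT) TO bound => hl.
(* From [Opt <= 2 L + Opt / 2] follows [Opt <= 4 L], and thinning gives [q L] at most the value of
   [p]. *)
have qO : q * Opt I <= 4 * value (path_tree p) (Defs.root I) 0.
  have := le_trans hd hp; set L := discounted _ _ _ _ _ _ in hl *.
  rewrite addn0 => h.
  have : q * Opt I <= q * (4 * L) by rewrite ler_pM2l //; lra.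
  by lra.
have -> : Opt I / (32 * ln x) = q * Opt I / 4.
  by rewrite /q /K; field; rewrite gt_eqF //; lra.
lra.
Qed.

Lemma dirac_policy_exists (p : seq V) : uniq p ->
  exists N : nonadaptive_policy R V, nonadaptive_value I N = path_value I p.
Proof.
move=> up; have sz : (size p <= #|V|)%N by rewrite -(card_uniqP up) max_card.
pose b := Bseq sz; pose f (r : #|V|.-bseq V) : R := (r == b)%:R.
have f0 r : 0 <= f r by rewrite ler0n.
have f1 : \sum_r f r = 1.
  by rewrite (bigD1 b) //= /f eqxx big1 ?addr0 // => r /negPf ->.
have fu r : f r != 0 -> uniq r.
  by rewrite /f; have [->|_] := eqVneq r b; rewrite ?eqxx.
exists (NonadaptivePolicy f0 f1 fu).
rewrite /nonadaptive_value (bigD1 b) //= /f eqxx mul1r big1 ?addr0 //.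
by move=> r /negPf ->; rewrite mul0r.
Qed.

End Policies.

(** * From the number of scales to [log log B] *)

Lemma log2_ge (R : realType) (n : nat) (x : R) :
  (2 ^ n)%:R <= x -> n%:R <= log2 x.
Proof.
move=> h; have ln2 : 0 < ln 2 :> R by rewrite ln_gt0 // ltr1n.
have p0 : 0 < (2 ^ n)%:R :> R by rewrite ltr0n expn_gt0.
rewrite /log2 ler_pdivlMr // mulr_natl -lnXn // -natrX ler_ln ?posrE //.
exact: lt_le_trans h.
Qed.

(** With [y = log2 B >= 2], the argument is at most [8 y <= y^4], and [ln y <= log2 y] because
    [ln 2 <= 1]. *)
Lemma ln_scales_le (R : realType) (B : nat) : (4 <= B)%N ->
  ln (4 * (scale B).+1%:R) <= 4 * log2 (log2 (B%:R : R)).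
Proof.
move=> B4; set y := log2 B%:R.
have ln2 : 0 < ln 2 :> R by rewrite ln_gt0 // ltr1n.
have ln21 : ln 2 <= 1 :> R by have := @le_ln1Dx R 1 ltac:(lra).
have y2 : 2 <= y by apply: (@log2_ge R 2); rewrite ler_nat.
(* The predecessor absorbs the shift in [scale]: [2 ^ scale B] is bounded by [B + 1], not by [B]. *)
have ny : (scale B).-1%:R <= y.
  apply: log2_ge; rewrite ler_nat.
  have : (2 ^ scale B <= B.+1)%N by apply: trunc_logP.
  case: (scale B) => [|k] /=; first by lia.
  by rewrite expnS; lia.
have n2 : (scale B).+1%:R <= 2 * y.
  apply: (@le_trans _ _ (((scale B).-1 + 2)%:R)); first by rewrite ler_nat; lia.
  by rewrite natrD; lra.
have y4 : 8 * y <= y ^+ 4.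
  have y3 : 2 ^+ 3 <= y ^+ 3 by rewrite lerXn2r ?nnegrE; lra.
  by rewrite exprSr ler_wpM2r //; lra.
have y0 : 0 < y by lra.
apply: (@le_trans _ _ (ln (y ^+ 4))).
  have n0 : 0 < (scale B).+1%:R :> R by rewrite ltr0n.
  by rewrite ler_ln ?posrE ?exprn_gt0 //; lra.
rewrite lnXn // -[leLHS]mulr_natl ler_pM2l //.
have lny : 0 <= ln y by rewrite ln_ge0 //; lra.
by rewrite /log2 ler_pdivlMr // ler_piMr.
Qed.

Theorem theorem2 (R : realType) :
  exists C : R, 0 < C /\
    forall (V : finType) (B : nat) (I : instance R V B), (4 <= B)%N ->
      exists N : nonadaptive_policy R V,
        Opt I / (C * log2 (log2 (B%:R : R))) <= nonadaptive_value I N.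
Proof.
(* [128 = 32 * 4], from [path_ge_Opt] and [ln_scales_le]. *)
exists 128; split => // V B I B4.
have [p up hp] := path_ge_Opt I (ltnSn (scale B)).
have [N NE] := dirac_policy_exists I up; exists N; rewrite NE.
apply: le_trans hp; apply: ler_wpM2l; first exact: Opt_ge0.
have lnx : 0 < ln (4 * (scale B).+1%:R) :> R.
  by rewrite ln_gt0 // -natrM ltr1n; lia.
have := ln_scales_le R B4.
by move=> h; rewrite lef_pV2 ?posrE; lra.
Qed.
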